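(* Let $(e_k)_{k\ge1}$ be an orthonormal basis of an infinite-dimensional Hilbert space $H$, let $(W_k)_{k\ge1}$ be independent standard real-valued Wiener processes on $(\Omega,\mathfrak F,\mathbb P)$, and let $(\sigma_k)_{k\ge1}$ be a sequence of nonnegative real numbers such that $$\sup_k\left\{-\frac{\sigma_k^2}{2}\sqrt{t-s}+\sigma_k\sqrt{2\log k}\right\}<+\infty,\qquad\forall\,0\le s<t.$$ For $0\le s<t$ put $$\zeta_k(s,t)=\exp\left\{-\frac{\sigma_k^2}{2}(t-s)+\sigma_k\left(W_k(t)-W_k(s)\right)\right\},\qquad\mathcal X(s,t)(x)=\sum_{k=1}^{+\infty}\zeta_k(s,t)\langle x,e_k\rangle_He_k,\quad x\in H.$$ Then the following holds for all $0\le s<t$: (i) If $l\in[0,+\infty]$ is an accumulation point of the sequence $(\sigma_k)$, then either $l=0$ or $l=+\infty$. (ii) If $\sigma_k\to0$, then $\sup_k\sigma_k\sqrt{\log k}<+\infty$. In particular, $\mathbb P$-a.s. the sequence $(\zeta_k(s,t))$ of eigenvalues of $\mathcal X(s,t)$ has accumulation points different from zero, hence $\mathcal X(s,t)$ is not compact $\mathbb P$-a.s. (iii) If $\sigma_k\to+\infty$, then $\frac{\sigma_k}{\sqrt{\log k}}\to+\infty$ and $\mathcal X(s,t)$ is trace class $\mathbb P$-a.s.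
   Context: Under the supremum hypothesis, $\sup_k\zeta_k(s,t)<+\infty$ $\mathbb P$-a.s., so $\mathcal X(s,t)$ is $\mathbb P$-a.s. a well-defined bounded symmetric positive definite operator on $H$ with eigenvectors $e_k$ and eigenvalues $\zeta_k(s,t)$. An accumulation point of a sequence is a limit in $[0,+\infty]$ of some subsequence. *)

(* Defs.v *)
From HB Require Import structures.
From mathcomp Require Import all_boot all_order all_algebra.
From mathcomp Require Import finmap.
From mathcomp Require Import all_classical all_reals all_analysis.

Set Implicit Arguments.
Unset Strict Implicit.
Unset Printing Implicit Defensive.

Import Order.TTheory GRing.Theory Num.Theory.
Import numFieldNormedType.Exports.

Local Open Scope classical_set_scope.
Local Open Scope ring_scope.

(* Sequences (x_k), k >= 1, are stored from index 0: x k stands for x_{k+1}. *)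

Section Sequences.
Context {R : realType}.

Definition accumulation_point (u : R^nat) (l : \bar R) : Prop :=
  exists2 phi : nat -> nat,
    {homo phi : m n / (m < n)%N} & (u (phi n))%:E @[n --> \oo] --> l.

End Sequences.

Section Probability.
Context d (T : measurableType d) (R : realType) (P : probability T R).

Definition independent_set_systems (I : choiceType) (F : I -> set (set T)) :
    Prop :=
  forall (J : {fset I}) (A : I -> set T),
    (forall i, i \in J -> F i (A i)) ->
    P (\bigcap_(i in [set` J]) A i) = (\prod_(i <- J) P (A i))%E.

Definition independent_RVs (I : choiceType) (X : I -> T -> R) : Prop :=
  independent_set_systems (fun i => g_sigma_algebra_preimage (X i)).

(* Processes are indexed by R, but only times t >= 0 are ever constrained. *)
Definition sigma_process (X : R -> T -> R) : set (set T) :=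
  <<s \bigcup_(t in [set t | 0 <= t]) g_sigma_algebra_preimage (X t) >>.

Definition independent_processes (I : choiceType) (X : I -> R -> T -> R) :
    Prop :=
  independent_set_systems (fun i => sigma_process (X i)).

(* [normal_prob m s] takes the standard deviation s, not the variance. *)
Record wiener_process (W : R -> {RV P >-> R}) : Prop := {
  wiener0 : {ae P, forall w, W 0 w = 0} ;
  wiener_increments : forall t : nat -> R, 0 <= t 0%N ->
    {homo t : m n / (m <= n)%N >-> m <= n} ->
    independent_RVs (fun n w => W (t n.+1) w - W (t n) w) ;
  wiener_gaussian : forall s t : R, 0 <= s -> s < t ->
    forall B : set R, measurable B ->
    P ((fun w => W t w - W s w) @^-1` B) = normal_prob 0 (Num.sqrt (t - s)) B ;
  wiener_continuous : {ae P, forall w,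
    {within [set t : R | 0 <= t], continuous (fun t => W t w)}} }.

Definition zeta (sigma : nat -> R) (W : nat -> R -> {RV P >-> R}) (s t : R)
    (k : nat) (w : T) : R :=
  expR (- (sigma k ^+ 2 / 2) * (t - s) + sigma k * (W k t w - W k s w)).

End Probability.

Section Operators.
Context {R : realType} {H : completeNormedModType R}.

(* A real Hilbert space is a complete normed module whose norm comes from a
   positive definite symmetric bilinear form. *)
Definition hilbert_inner (ip : {dot H for idfun}) : Prop :=
  forall x, `|x| ^+ 2 = ip x x.

Variable ip : {dot H for idfun}.

Definition orthonormal_sequence (e : nat -> H) : Prop :=
  forall j k, ip (e j) (e k) = (j == k)%:R.

(* Being indexed by nat, such a basis forces H to be infinite-dimensional. *)
Definition orthonormal_basis (e : nat -> H) : Prop :=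
  orthonormal_sequence e /\
  dense [set x | exists n (c : nat -> R), x = \sum_(k < n) c k *: e k].

Definition bounded_operator (A : H -> H) : Prop :=
  linear A /\ exists M : R, forall x, `|A x| <= M * `|x|.

Definition compact_operator (A : H -> H) : Prop :=
  bounded_operator A /\ precompact (A @` [set x | `|x| <= 1]).

Definition adjoint (A B : H -> H) : Prop := forall x y, ip (A x) y = ip x (B y).

Definition positive_operator (A : H -> H) : Prop :=
  [/\ bounded_operator A, adjoint A A & forall x, 0 <= ip (A x) x].

(* B = |A|, the positive square root of A^* A. *)
Definition absolute_value (A B : H -> H) : Prop :=
  positive_operator B /\
  exists2 A' : H -> H, adjoint A A' & forall x, B (B x) = A' (A x).

(* tr |A| < +oo. *)
Definition trace_class (A : H -> H) : Prop :=
  bounded_operator A /\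
  exists2 B : H -> H, absolute_value A B &
    forall f : nat -> H, orthonormal_basis f ->
      cvgn (series (fun k => ip (B (f k)) (f k))).

Definition diag_series (e : nat -> H) (z : nat -> R) (x : H) : nat -> H :=
  series (fun k => (z k * ip x (e k)) *: e k).

(* A limit is a total function: diag_op is the operator
   x |-> sum_k z_k <x, e_k> e_k only under diag_defined. *)
Definition diag_op (e : nat -> H) (z : nat -> R) (x : H) : H :=
  limn (diag_series e z x).

Definition diag_defined (e : nat -> H) (z : nat -> R) : Prop :=
  forall x, cvgn (diag_series e z x).

End Operators.

(* Main.v *)
Require Import Defs.
From HB Require Import structures.
From mathcomp Require Import all_boot all_order all_algebra.
From mathcomp Require Import finmap.
From mathcomp Require Import all_classical all_reals all_analysis.
From mathcomp Require Import measurable_realfun ring lra.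

(** Write [L_k = sqrt (log k)] and [xi_k = W_k(t) - W_k(s)], a Gaussian variable
    of variance [t - s].

    Since [sqrt (t - s)] may be any positive number, the hypothesis on [sigma]
    says that for every [a > 0] there is [C] with
    [sigma_k L_k <= C + a sigma_k^2] for all [k]
    ([sigma_sqrt_log_le_of_sup]). As [L_k] tends to infinity, [sigma] cannot
    stay between two positive constants along a subsequence
    ([accumulation_point_0y]). If [sigma] is bounded, then so is [sigma_k L_k]
    ([sigma_sqrt_log_bounded]). If [sigma] tends to infinity, then [C] is
    absorbed by [a sigma_k^2], and [sigma_k / L_k] eventually exceeds any
    constant because [a] is arbitrary ([near_sqrt_log_le_sigma]).

    Two facts on the increments are used. By the Gaussian tail and the first
    Borel-Cantelli lemma, almost surely [xi_k <= 3 sqrt (t - s) L_k] for all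
    large [k] ([ae_increment_le]). By independence and equality in law, there is
    a constant [K] such that almost surely [xi_k >= - K] for infinitely many [k]
    ([ae_increment_ge]).

    If [sigma] tends to [0], the first fact bounds [sigma_k xi_k] from above,
    so the eigenvalues are bounded and the diagonal operator is well defined
    and bounded; the second one keeps infinitely many eigenvalues above a
    positive constant, which yields a nonzero accumulation point by
    Bolzano-Weierstrass and excludes compactness ([diag_op_not_compact]). If
    [sigma] tends to infinity, the term [- sigma_k^2 (t - s) / 2] dominates
    both [sigma_k xi_k] and [2 log k], so that the eigenvalues are eventually
    at most [1 / k^2] ([eigenvalues_summable]); a diagonal operator with
    summable nonnegative eigenvalues is trace class ([trace_class_diag_op]). *)

Set Implicit Arguments.
Unset Strict Implicit.
Unset Printing Implicit Defensive.

Import Order.TTheory GRing.Theory Num.Theory.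
Import numFieldNormedType.Exports.

Local Open Scope classical_set_scope.
Local Open Scope ring_scope.

(** * Diagonal operators on a Hilbert space *)

Section Summable.
Context {R : realType}.
Variables (z : nat -> R) (z_ge0 : forall k, 0 <= z k).
Hypothesis z_sum : cvgn (series z).

Lemma series_le_lim n : series z n <= limn (series z).
Proof. by apply: nondecreasing_cvgn_le => //; exact: nondecreasing_series. Qed.

Lemma summable_le_lim k : `|z k| <= limn (series z).
Proof.
rewrite ger0_norm //; apply: le_trans (series_le_lim k.+1).
by rewrite /series /= big_nat_recr //= lerDr sumr_ge0.
Qed.

End Summable.

Section InnerProduct.
Context {R : realType} {H : completeNormedModType R}.
Variables (ip : {dot H for idfun}) (ip_hilbert : hilbert_inner ip).
Implicit Types x y : H.

Lemma ipC x y : ip x y = ip y x.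
Proof. by rewrite hermC expr0 mul1r. Qed.

Lemma ip_suml (I : Type) (r : seq I) (F : I -> H) y :
  ip (\sum_(i <- r) F i) y = \sum_(i <- r) ip (F i) y.
Proof. by rewrite linear_sumlz. Qed.

Lemma ip_sumr (I : Type) (r : seq I) (F : I -> H) y :
  ip y (\sum_(i <- r) F i) = \sum_(i <- r) ip y (F i).
Proof. by rewrite linear_sumr. Qed.

Lemma ipZl a x y : ip (a *: x) y = a * ip x y.
Proof. by rewrite linearZl_LR. Qed.

Lemma ipZr a x y : ip x (a *: y) = a * ip x y.
Proof. by rewrite linearZr_LR. Qed.

Lemma ipDl x y w : ip (x + y) w = ip x w + ip y w.
Proof. exact: linearDl. Qed.

Lemma ipBl x y w : ip (x - y) w = ip x w - ip y w.
Proof. exact: linearBl. Qed.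

Lemma ipDr x y w : ip w (x + y) = ip w x + ip w y.
Proof. exact: linearDr. Qed.

Lemma ipBr x y w : ip w (x - y) = ip w x - ip w y.
Proof. exact: linearBr. Qed.

(** Writing the inner product through the norm gives its continuity for free. *)
Lemma polarization x y :
  ip x y = (`|x + y| ^+ 2 - `|x| ^+ 2 - `|y| ^+ 2) / 2.
Proof.
rewrite !ip_hilbert ipDl !ipDr (ipC y x).
by field.
Qed.

Lemma cvg_ipl (u : nat -> H) x y :
  u n @[n --> \oo] --> x -> ip (u n) y @[n --> \oo] --> ip x y.
Proof.
move=> ux; rewrite polarization; under eq_fun do rewrite polarization.
apply: cvgMl; apply: cvgB; last exact: cvg_cst.
apply: cvgB; rewrite !expr2; apply: cvgM; apply: cvg_norm => //.
all: apply: cvgD => //; exact: cvg_cst.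
Qed.

Section Orthonormal.
Variables (e : nat -> H) (e_on : orthonormal_sequence ip e).

Lemma ip_basis_sum (c : nat -> R) m n j :
  ip (\sum_(m <= k < n) c k *: e k) (e j) = if (m <= j < n)%N then c j else 0.
Proof.
rewrite ip_suml; under eq_bigr do rewrite ipZl e_on.
case: ifP => [jmn|jmn].
  rewrite (bigD1_seq j) ?iota_uniq ?mem_index_iota//= eqxx mulr1.
  by rewrite big1 ?addr0 // => i /negPf ->; rewrite mulr0.
rewrite big_nat big1 // => i imn; case: eqP => [ij|_]; last by rewrite mulr0.
by rewrite -ij imn in jmn.
Qed.

Lemma norm_basis_sum (c : nat -> R) m n :
  `|\sum_(m <= k < n) c k *: e k| ^+ 2 = \sum_(m <= k < n) c k ^+ 2.
Proof.
rewrite ip_hilbert ip_sumr big_nat [RHS]big_nat; apply: eq_bigr => k kmn.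
by rewrite ipZr ip_basis_sum kmn.
Qed.

Lemma norm_basis k : `|e k| = 1.
Proof.
by apply/eqP; rewrite -sqrp_eq1 // ip_hilbert e_on eqxx.
Qed.

(** Expanding [0 <= |x - s|^2], where [s] is the partial Fourier sum of [x]. *)
Lemma bessel x n : \sum_(0 <= k < n) ip x (e k) ^+ 2 <= `|x| ^+ 2.
Proof.
set s := \sum_(0 <= k < n) ip x (e k) *: e k.
have sE : ip s s = \sum_(0 <= k < n) ip x (e k) ^+ 2.
  by rewrite -ip_hilbert norm_basis_sum.
have xsE : ip x s = \sum_(0 <= k < n) ip x (e k) ^+ 2.
  by rewrite ip_sumr; apply: eq_bigr => k _; rewrite ipZr -expr2.
have := sqr_ge0 `|x - s|; rewrite [X in _ <= X]ip_hilbert.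
rewrite ipBl !ipBr (ipC s x) sE xsE -ip_hilbert.
lra.
Qed.

Lemma cvg_bessel x : cvgn (series (fun k => ip x (e k) ^+ 2)).
Proof.
apply: nondecreasing_is_cvgn.
  by apply: nondecreasing_series => k _ _; exact: sqr_ge0.
by exists (`|x| ^+ 2) => _ [n _ <-]; exact: bessel.
Qed.

(** Riesz-Fischer: by orthogonality the squared norm of a block of the series
    is a block of the series of squares, so both are Cauchy together. *)
Lemma cvg_basis_series (c : nat -> R) :
  cvgn (series (fun k => c k ^+ 2)) -> cvgn (series (fun k => c k *: e k)).
Proof.
move=> /cauchy_cvgP/cauchy_seriesP c2; apply/cauchy_cvgP/cauchy_seriesP => r r0.
apply: filterS (c2 (r ^+ 2) (exprn_gt0 _ r0)) => -[m n] /=.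
rewrite -norm_basis_sum ger0_norm ?sqr_ge0 //.
by rewrite ltr_pXn2r // ?nnegrE // ltW.
Qed.

Section Diagonal.
Variables (z : nat -> R) (M : R) (z_bnd : forall k, `|z k| <= M).

Let M_ge0 : 0 <= M. Proof. exact: le_trans (z_bnd 0). Qed.

Let zx2_le x k : (z k * ip x (e k)) ^+ 2 <= M ^+ 2 * ip x (e k) ^+ 2.
Proof.
rewrite exprMn ler_wpM2r ?sqr_ge0 // -(real_normK (num_real (z k))).
by rewrite ler_pXn2r ?nnegrE.
Qed.

Lemma diag_definedP : diag_defined ip e z.
Proof.
move=> x; apply: cvg_basis_series.
apply: (@series_le_cvg _ _ (fun k => M ^+ 2 * ip x (e k) ^+ 2)).
- by move=> k; exact: sqr_ge0.
- by move=> k; rewrite mulr_ge0 ?sqr_ge0.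
- by move=> k; exact: zx2_le.
- have -> : series (fun k => M ^+ 2 * ip x (e k) ^+ 2) =
      (fun n => M ^+ 2 * series (fun k => ip x (e k) ^+ 2) n).
    by apply/funext => n; rewrite /series /= mulr_sumr.
  by apply: is_cvgMr; exact: cvg_bessel.
Qed.

Lemma diag_op_cvg x : diag_series ip e z x n @[n --> \oo] --> diag_op ip e z x.
Proof. exact: diag_definedP. Qed.

Lemma diag_op_linear : linear (diag_op ip e z).
Proof.
move=> a x y; apply: cvg_lim => //.
have -> : diag_series ip e z (a *: x + y) =
    (fun n => a *: diag_series ip e z x n + diag_series ip e z y n).
  apply/funext => n; rewrite /diag_series /series /= scaler_sumr -big_split /=.
  apply: eq_bigr => k _.
  by rewrite ipDl ipZl mulrDr scalerDl scalerA mulrCA.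
apply: cvgD; last exact: diag_op_cvg.
by apply: cvgZr; exact: diag_op_cvg.
Qed.

Lemma diag_op_norm x : `|diag_op ip e z x| <= M * `|x|.
Proof.
rewrite -(@ler_pXn2r _ 2) ?nnegrE ?mulr_ge0 // exprMn.
have h : `|diag_series ip e z x n| ^+ 2 @[n --> \oo] -->
    `|diag_op ip e z x| ^+ 2.
  by rewrite expr2; under eq_fun do rewrite expr2;
    apply: cvgM; apply: cvg_norm; exact: diag_op_cvg.
rewrite -(cvg_lim _ h) //; apply: limr_le.
  by apply/cvg_ex; eexists; exact: h.
apply: nearW => n; rewrite /diag_series /series /= norm_basis_sum.
apply: (@le_trans _ _ (M ^+ 2 * \sum_(0 <= k < n) ip x (e k) ^+ 2)).
  by rewrite mulr_sumr; apply: ler_sum.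
by rewrite ler_wpM2l ?sqr_ge0 // bessel.
Qed.

Lemma diag_op_bounded : bounded_operator (diag_op ip e z).
Proof. by split; [exact: diag_op_linear | exists M; exact: diag_op_norm]. Qed.

Lemma diag_op_eigen k : diag_op ip e z (e k) = z k *: e k.
Proof.
apply: cvg_lim => //; apply: cvg_near_cst; exists k.+1 => //= n kn.
rewrite /diag_series /series /= (bigD1_seq k) ?iota_uniq ?mem_index_iota//=.
rewrite e_on eqxx mulr1 big1 ?addr0 // => j jk.
by rewrite e_on eq_sym (negPf jk) mulr0 scale0r.
Qed.

Lemma ip_diag_op x y :
  \sum_(0 <= k < n) z k * (ip x (e k) * ip y (e k)) @[n --> \oo] -->
    ip (diag_op ip e z x) y.
Proof.
have -> : (fun n => \sum_(0 <= k < n) z k * (ip x (e k) * ip y (e k))) =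
    (fun n => ip (diag_series ip e z x n) y).
  apply/funext => n; rewrite /diag_series /series /= ip_suml.
  by apply: eq_bigr => k _; rewrite ipZl (ipC (e k)) mulrA.
exact/cvg_ipl/diag_op_cvg.
Qed.

(** The series of [ip_diag_op] is symmetric in [x] and [y]. *)
Lemma diag_op_adjoint : adjoint ip (diag_op ip e z) (diag_op ip e z).
Proof.
move=> x y; rewrite (ipC x).
have := @ip_diag_op y x.
under eq_fun do under eq_bigr do rewrite (mulrC (ip y _)).
by move=> yx; rewrite -(cvg_lim _ (@ip_diag_op x y)) // (cvg_lim _ yx).
Qed.

Lemma diag_op_positive :
  (forall k, 0 <= z k) -> positive_operator ip (diag_op ip e z).
Proof.
move=> z0; split; [exact: diag_op_bounded|exact: diag_op_adjoint|move=> x].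
have h := @ip_diag_op x x; rewrite -(cvg_lim _ h) //; apply: limr_ge.
  by apply/cvg_ex; eexists; exact: h.
apply: nearW => n; apply: sumr_ge0 => k _.
by rewrite mulr_ge0 // -expr2 sqr_ge0.
Qed.

End Diagonal.

End Orthonormal.

(** A nonnegative diagonal operator is its own absolute value. In any
    orthonormal system [f], exchanging sums turns the partial traces into
    [sum_k z_k * (sum_(j < n) <e_k, f_j>^2)], and by Bessel's inequality for
    [f] each inner sum is at most [|e_k|^2 = 1]. Hence the partial traces, which
    increase, are bounded by [sum_k z_k]. *)
Lemma trace_class_diag_op (e : nat -> H) (z : nat -> R) :
  orthonormal_sequence ip e -> (forall k, 0 <= z k) -> cvgn (series z) ->
  trace_class ip (diag_op ip e z).
Proof.
move=> e_on z0 zcvg.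
have zle := series_le_lim z0 zcvg; have zM := summable_le_lim z0 zcvg.
split; first exact: diag_op_bounded zM.
exists (diag_op ip e z).
  split; first exact: diag_op_positive zM z0.
  by exists (diag_op ip e z) => //; exact: diag_op_adjoint zM.
move=> f [f_on _]; apply: nondecreasing_is_cvgn.
  apply: nondecreasing_series => k _ _.
  by case: (diag_op_positive e_on zM z0).
exists (limn (series z)) => _ [n _ <-].
have h : \sum_(0 <= k < N) z k * \sum_(0 <= j < n) ip (e k) (f j) ^+ 2
    @[N --> \oo] --> series (fun j => ip (diag_op ip e z (f j)) (f j)) n.
  have -> : (fun N => \sum_(0 <= k < N) z k *
      \sum_(0 <= j < n) ip (e k) (f j) ^+ 2) = (fun N => \sum_(0 <= j < n)
      \sum_(0 <= k < N) z k * (ip (f j) (e k) * ip (f j) (e k))).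
    apply/funext => N; rewrite exchange_big /=; apply: eq_bigr => k _.
    by rewrite mulr_sumr; apply: eq_bigr => j _; rewrite (ipC (e k)) expr2.
  apply: cvg_big => [|j _]; first exact: add_continuous.
  exact: ip_diag_op zM _ _.
rewrite -(cvg_lim _ h) //; apply: limr_le.
  by apply/cvg_ex; eexists; exact: h.
apply: nearW => N; apply: le_trans (zle N).
apply: ler_sum => k _; rewrite ler_piMr //.
by apply: le_trans (bessel f_on _ _) _; rewrite norm_basis // expr1n.
Qed.

(** The images of infinitely many unit vectors [e_k] stay at pairwise distance
    at least [c], because
    [|z_m e_m - z_n e_n|^2 = z_m^2 + z_n^2 >= c^2]. A cluster point of these
    images would have two of them within [c / 2], a contradiction. *)
Lemma diag_op_not_compact (e : nat -> H) (z : nat -> R) (M c : R) :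
  orthonormal_sequence ip e -> (forall k, `|z k| <= M) -> 0 < c ->
  infinite_set [set k | c <= z k] -> ~ compact_operator (diag_op ip e z).
Proof.
move=> e_on zM c0 zoo [_ [K imK [cK _]]].
have /= [|f [fincr _ fc]] := infinite_increasing_seq_wf _ zoo 0.
  by move=> n; apply: sub_finite_set (finite_II n.+1) => m /=.
pose v n : H := diag_op ip e z (e (f n)).
have [|p [_ /= vp]] := cK (v n @[n --> \oo]) _.
  exists 0 => // n _ /=; apply: imK; exists (e (f n)) => //=.
  by rewrite norm_basis.
have pb : nbhs p (ball p (c / 2)) by apply: nbhsx_ballx; rewrite divr_gt0.
have often N : exists2 n, (N <= n)%N & ball p (c / 2) (v n).
  have [|_ [[n Nn <-] bn]] := vp [set v n | n in [set n | (N <= n)%N]] _ _ pb.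
    by exists N => // n Nn; exists n.
  by exists n.
have [m _ pm] := often 0; have [n mn pn] := often m.+1.
have : `|v m - v n| < c.
  move: pm pn; rewrite -!ball_normE /= => pm pn.
  rewrite (_ : v m - v n = (p - v n) - (p - v m)); last first.
    by rewrite opprB [RHS]addrC addrA subrK.
  by rewrite (splitr c) (le_lt_trans (ler_normB _ _)) // ltrD.
apply/negP; rewrite -leNgt -(@ler_pXn2r _ 2) ?nnegrE ?(ltW c0) //.
rewrite /v !(diag_op_eigen e_on) ip_hilbert ipBl !ipBr.
rewrite !ipZl !ipZr !e_on !eqxx.
have /negPf fmn : f m != f n.
  by rewrite (inj_eq (incn_inj fincr)) ltn_eqF.
rewrite fmn eq_sym fmn !mulr0 !mulr1 sub0r opprK subr0.
have := fc m; have := fc n; rewrite /= => cn cm.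
rewrite -!expr2 -[X in X <= _]addr0 lerD ?sqr_ge0 //.
by rewrite ler_pXn2r ?nnegrE ?(ltW c0) // (le_trans (ltW c0)).
Qed.

End InnerProduct.

(** * Gaussian tails and Borel-Cantelli lemmas *)

Section Gaussian.
Context {R : realType}.

(** On [x >= a], one half of the exponent [x^2 / (2 s^2)] is bounded below by
    its value at [a]; the other half is the exponent of the normal density with
    standard deviation [sqrt 2 * s]. The factor [sqrt 2] is the ratio of the
    normalizing constants. This gives a Gaussian tail without computing any
    integral. *)
Lemma normal_pdf_tail (s a x : R) : 0 < s -> 0 <= a -> a <= x ->
  normal_pdf 0 s x <=
    Num.sqrt 2 * expR (- (a ^+ 2 / (4 * s ^+ 2))) *
      normal_pdf 0 (Num.sqrt 2 * s) x.
Proof.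
move=> s0 a0 ax; have s20 : 0 < Num.sqrt 2 * s by rewrite mulr_gt0 ?sqrtr_gt0.
rewrite !normal_pdfE ?gt_eqF // /normal_fun /normal_peak !subr0.
have -> : (Num.sqrt 2 * s) ^+ 2 = 2 * s ^+ 2 by rewrite exprMn sqr_sqrtr.
have -> : 2 * s ^+ 2 * pi *+ 2 = 2 * (s ^+ 2 * pi *+ 2).
  by rewrite mulrnAr mulrA.
rewrite sqrtrM // (invfM (Num.sqrt 2)).
rewrite [leRHS](_ : _ = (Num.sqrt (s ^+ 2 * pi *+ 2))^-1 *
   (expR (- (a ^+ 2 / (4 * s ^+ 2))) *
    expR (- x ^+ 2 / (2 * s ^+ 2 *+ 2)))); last first.
  have : Num.sqrt 2 != 0 :> R by rewrite gt_eqF ?sqrtr_gt0.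
  move: (Num.sqrt (s ^+ 2 * pi *+ 2))^-1 (Num.sqrt 2) => p r r0.
  by field.
rewrite ler_wpM2l ?invr_ge0 ?sqrtr_ge0 // -expRD ler_expR.
rewrite -subr_ge0 [leRHS](_ : _ = (x ^+ 2 - a ^+ 2) / (4 * s ^+ 2)); last first.
  by field; rewrite gt_eqF.
apply: divr_ge0; last by rewrite mulr_ge0 ?sqr_ge0.
by rewrite subr_ge0 ler_pXn2r ?nnegrE // (le_trans a0).
Qed.

Lemma normal_prob_tail (s a : R) : 0 < s -> 0 <= a ->
  (normal_prob 0 s `]a, +oo[ <=
    (Num.sqrt 2 * expR (- (a ^+ 2 / (4 * s ^+ 2))))%:E)%E.
Proof.
move=> s0 a0; set K := _ * expR _.
have K0 : 0 <= K by rewrite mulr_ge0 ?sqrtr_ge0 ?expR_ge0.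
apply: (@le_trans _ _ (K%:E * normal_prob 0 (Num.sqrt 2 * s) `]a, +oo[)%E).
  rewrite /normal_prob -ge0_integralZl //=.
  - apply: ge0_le_integral => //=.
    + by move=> x _; rewrite lee_fin normal_pdf_ge0.
    + apply/measurable_EFinP; apply: measurable_funTS.
      exact: measurable_normal_pdf.
    + apply/measurable_EFinP/measurable_funTS/measurable_funM => //.
      exact: measurable_normal_pdf.
    + move=> x; rewrite in_itv /= andbT => /ltW ax.
      by rewrite -EFinM lee_fin normal_pdf_tail.
  - apply/measurable_EFinP; apply: measurable_funTS.
    exact: measurable_normal_pdf.
  - by move=> x _; rewrite lee_fin normal_pdf_ge0.
by rewrite -[leRHS]mule1 lee_pmul ?lee_fin // ?probability_le1.
Qed.

(** Otherwise the half-lines with left end [- n] would all be null sets, while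
    they cover the real line. *)
Lemma probability_half_line (mu : probability (measurableTypeR R) R) :
  exists n : nat, (mu [set x : R | (x < - n%:R)%R] < 1)%E.
Proof.
apply/not_existsP => h.
suff : mu.-negligible [set: R].
  move/(negligibleP _ measurableT); rewrite [LHS](probability_setT mu).
  by move/eqP; rewrite onee_eq0.
have m n : measurable [set x : R | x < - n%:R].
  by rewrite -set_itvNyo; exact: measurable_itv.
have -> : [set: R] = \bigcup_n ~` [set x : R | x < - n%:R].
  apply/seteqP; split => // x _; exists (Num.truncn `|x|).+1 => //=.
  apply/negP; rewrite -leNgt lerNl; apply: le_trans (ltW (truncnS_gt _)).
  by rewrite -normrN ler_norm.
apply: negligible_bigcup => n; apply/(negligibleP mu (measurableC (m n))).
rewrite [LHS](probability_setC mu (m n)).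
have -> : mu [set x : R | x < - n%:R] = 1%E.
  apply/eqP; rewrite eq_le; apply/andP; split.
    exact: (probability_le1 mu (m n)).
  by rewrite leNgt; apply/negP; exact: h.
by rewrite subee.
Qed.

End Gaussian.

Section AlmostSure.
Context d (T : measurableType d) (R : realType) (P : probability T R).

(** The first Borel-Cantelli lemma, stated for the complements. *)
Lemma ae_eventually (A : nat -> set T) (u : nat -> R) :
  (forall k, measurable (A k)) -> (forall k, (P (~` A k) <= (u k)%:E)%E) ->
  cvgn (series u) -> {ae P, forall w, \forall k \near \oo, A k w}.
Proof.
move=> mA PA cu.
have mCA k : measurable (~` A k) by exact: measurableC.
have u0 k : 0 <= u k by rewrite -lee_fin (le_trans _ (PA k)).
have lt : (\sum_(k <oo) P (~` A k) < +oo)%E.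
  apply: (@le_lt_trans _ _ (limn (series u))%:E); last exact: ltry.
  apply: lime_le; first exact: is_cvg_nneseries.
  apply: nearW => n; apply: (@le_trans _ _ (\sum_(0 <= k < n) (u k)%:E)%E).
    exact: lee_sum.
  rewrite sumEFin lee_fin.
  exact: series_le_lim.
have := lim_sup_set_cvg0 mCA lt.
rewrite -negligibleP; last first.
  by apply: bigcap_measurable => // n _; exact: bigcup_measurable.
apply: negligibleS => w /= nA n _ /=; apply: contrapT => h; apply: nA.
exists n => // k /= nk; apply: contrapT => Ak; apply: h.
by exists k.
Qed.

(** The second Borel-Cantelli lemma for independent events of equal
    probability [q < 1]: by independence [m] consecutive ones all occur with
    probability [q ^ m], so almost surely no tail of the sequence occurs
    entirely. *)
Lemma ae_infinitely_often (F : nat -> set (set T)) (A : nat -> set T) (q : R) :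
  independent_set_systems P F -> (forall k, F k (A k)) ->
  (forall k, measurable (A k)) -> q < 1 -> (forall k, P (A k) = q%:E) ->
  {ae P, forall w, infinite_set [set k | ~ A k w]}.
Proof.
move=> indF FA mA q1 PA.
have q0 : 0 <= q by rewrite -lee_fin -(PA 0).
suff : P.-negligible (\bigcup_N \bigcap_(k in [set k | (N <= k)%N]) A k).
  apply: negligibleS => w /= /contrapT/finite_fsetP[J JE].
  exists (\max_(i <- J) i).+1 => // k /= Jk; apply: contrapT => Ak.
  have : k \in J by have : [set k | ~ A k w] k by []; rewrite JE.
  move=> kJ; move: Jk; rewrite ltnNge => /negP; apply.
  exact: (@leq_bigmax_seq _ _ xpredT id).
apply: negligible_bigcup => N.
have mB : measurable (\bigcap_(k in [set k | (N <= k)%N]) A k).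
  by apply: bigcap_measurableType => k _; exact: mA.
apply/negligibleP => //; apply/eqP; rewrite eq_le measure_ge0 andbT.
have qm m : (P (\bigcap_(k in [set k | (N <= k)%N]) A k) <= (q ^+ m)%:E)%E.
  pose J : {fset nat} := [fset k in iota N m]%fset.
  have -> : (q ^+ m)%:E = (\prod_(i <- J) P (A i))%E.
    under eq_bigr do rewrite PA.
    rewrite prodEFin big_const_seq count_predT iter_mulr_1; congr (_ ^+ _)%:E.
    by have := card_fseq (iota N m); rewrite undup_id ?iota_uniq // size_iota.
  rewrite -indF //; apply: le_measure; rewrite ?inE //.
    by apply: bigcap_measurableType => k _; exact: mA.
  move=> w h k /=; rewrite !inE mem_iota => /andP[Nk _]; exact: h.
rewrite -[X in (X <= _)%E]fineK ?fin_num_measure // lee_fin.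
have q1' : `|q| < 1 by rewrite ger0_norm.
rewrite -(cvg_lim _ (cvg_expr q1')) //; apply: limr_ge.
  by apply/cvg_ex; exists 0; exact: cvg_expr.
apply: nearW => m.
by rewrite -lee_fin fineK ?fin_num_measure.
Qed.

(** Independence of the processes is stated for the sigma-algebras that they
    generate; this makes it applicable to events about increments. *)
Lemma sigma_process_increment (X : R -> T -> R) (s t : R) (B : set R) :
  0 <= s -> 0 <= t -> measurable B ->
  sigma_process X ((fun w => X t w - X s w) @^-1` B).
Proof.
move=> s0 t0 mB.
pose G := \bigcup_(t in [set t | 0 <= t]) g_sigma_algebra_preimage (X t).
have mX r : 0 <= r ->
    measurable_fun [set: g_sigma_algebraType G]
      (X r : g_sigma_algebraType G -> R).
  move=> r0 _ C mC; rewrite setTI; apply: sub_sigma_algebra.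
  by exists r => //; exists C => //; rewrite setTI.
have := measurable_funB (mX t t0) (mX s s0) measurableT mB.
by rewrite setTI.
Qed.

End AlmostSure.

(** * Real sequences *)

Section Sequences.
Context {R : realType}.
Implicit Types u : nat -> R.

Lemma near_le_bounded u (c : R) :
  (\forall k \near \oo, u k <= c) -> exists M, forall k, u k <= M.
Proof.
move=> [N _ Nu]; exists (`|c| + \sum_(i < N) `|u i|) => k.
case: (ltnP k N) => [kN|/Nu/= uc].
  apply: (le_trans (ler_norm _)); rewrite (bigD1 (Ordinal kN)) //=.
  by rewrite addrCA lerDl addr_ge0 // sumr_ge0.
by apply: (le_trans uc); apply: (le_trans (ler_norm _)); rewrite lerDl sumr_ge0.
Qed.

(** Indices are shifted by one, hence the successor under the logarithm. *)
Definition sqrt_log (k : nat) : R := Num.sqrt (ln k.+1%:R).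

Lemma sqrt_log_ge0 k : 0 <= sqrt_log k. Proof. exact: sqrtr_ge0. Qed.

Lemma sqr_sqrt_log k : sqrt_log k ^+ 2 = ln k.+1%:R.
Proof. by rewrite sqr_sqrtr // ln_ge0 // ler1n. Qed.

(** This is how Gaussian bounds at level [sqrt_log k] become summable. *)
Lemma expR_sqrt_log k : expR (- (2 * sqrt_log k ^+ 2)) = (k.+1%:R ^+ 2)^-1.
Proof. by rewrite sqr_sqrt_log expRN expRM_natl lnK // posrE. Qed.

Lemma sqrt_log_cvgy : sqrt_log k @[k --> \oo] --> +oo.
Proof.
apply/cvgryPge => B; exists (Num.truncn (expR (B ^+ 2))) => // k /= Bk.
apply: (le_trans (ler_norm B)); rewrite -(sqrtr_sqr B); apply: ler_wsqrtr.
rewrite -[B ^+ 2]expRK ler_ln ?posrE ?expR_gt0 //.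
by apply: (le_trans (ltW (truncnS_gt _))); rewrite ler_nat.
Qed.

Lemma cvg_series_inv_sqr : cvgn (series (fun k => (k.+1%:R ^+ 2)^-1 : R)).
Proof.
apply: nondecreasing_is_cvgn.
  by apply: nondecreasing_series => k _ _; rewrite invr_ge0 sqr_ge0.
exists 2 => _ [n _ <-].
(* A telescoping bound: [1 / (x + 1)^2 <= 1 / x - 1 / (x + 1)]; the case
   [n = 0] relies on [0^-1 = 0]. *)
suff : series (fun k => (k.+1%:R ^+ 2)^-1 : R) n <= 2 - n%:R^-1.
  by move/le_trans; apply; rewrite gerBl invr_ge0.
rewrite /series /=; elim: n => [|n IH]; first by rewrite big_geq // invr0 subr0.
rewrite big_nat_recr //=; case: n IH => [_|n IH].
  by rewrite big_geq //; lra.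
apply: (le_trans (lerD IH (lexx _))).
rewrite -addrA lerD2l -[n.+2%:R]natr1.
have : 0 < n.+1%:R :> R by [].
move: (n.+1%:R : R) => x x0.
rewrite -subr_ge0 (_ : _ - _ = (x * (x + 1) ^+ 2)^-1); last first.
  by field; rewrite !gt_eqF // addr_gt0.
by rewrite invr_ge0 mulr_ge0 ?sqr_ge0 // ltW.
Qed.

Lemma accumulation_point_ge u (A : set nat) (c M : R) :
  infinite_set A -> (forall k, A k -> c <= u k) -> (forall k, `|u k| <= M) ->
  exists2 l : R, c <= l & accumulation_point u l%:E.
Proof.
move=> Aoo cu uM.
have /= [|f [fincr _ fA]] := infinite_increasing_seq_wf _ Aoo 0.
  by move=> n; apply: sub_finite_set (finite_II n.+1) => m /=.
have [|g gincr cg] := bolzano_weierstrass (u_ := u \o f).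
  exists M; split; first exact: num_real.
  by move=> x Mx n _ /=; exact: le_trans (uM _) (ltW Mx).
exists (limn (u \o f \o g)).
  by apply: limr_ge => //; apply: nearW => n; apply: cu; exact: fA.
exists (f \o g).
  by move=> m n mn /=; rewrite (leqW_mono fincr) (leqW_mono gincr).
by apply/fine_cvgP; split; [exact: nearW | exact: cg].
Qed.

End Sequences.

(** * Consequences of the supremum hypothesis *)

(** As [s] and [t] vary, [a = sqrt (t - s)] takes every positive value. Since
    [a] is arbitrary, replacing [a / 2] by [a] and [sqrt 2] by [1] keeps the
    strength of the hypothesis up to a change of constants. *)
Lemma sigma_sqrt_log_le_of_sup (R : realType) (sigma : nat -> R)
  (sigma_ge0 : forall k, 0 <= sigma k)
  (sigma_sup : forall s t : R, 0 <= s -> s < t ->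
    (ereal_sup (range (fun k : nat =>
       (- (sigma k ^+ 2 / 2) * Num.sqrt (t - s)
        + sigma k * Num.sqrt (2 * ln (k.+1%:R)))%:E)) < +oo)%E) (a : R) :
  0 < a -> exists C, forall k, sigma k * sqrt_log k <= C + a * sigma k ^+ 2.
Proof.
move=> a0; have /(sigma_sup _ _ (lexx 0)) : 0 < a ^+ 2 by rewrite exprn_gt0.
rewrite subr0 sqrtr_sqr gtr0_norm //.
set E := ereal_sup _ => Eoo.
have ub k : ((- (sigma k ^+ 2 / 2) * a
    + sigma k * Num.sqrt (2 * ln (k.+1%:R)))%:E <= E)%E.
  by apply: ereal_sup_ubound; exists k.
have fE : E \is a fin_num.
  rewrite fin_numE (lt_eqF Eoo) andbT; apply/eqP => EN.
  by have := ub 0; rewrite EN leeNy_eq.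
exists (fine E) => k.
have := ub k; rewrite -(fineK fE) lee_fin sqrtrM // -/(sqrt_log k) => h.
have s2 : 1 <= Num.sqrt 2 :> R.
  by rewrite -[X in X <= _]sqrtr1 ler_wsqrtr // ler1n.
have h1 : sigma k * sqrt_log k <= sigma k * (Num.sqrt 2 * sqrt_log k).
  by rewrite ler_wpM2l // ler_peMl // sqrt_log_ge0.
have h2 : 0 <= sigma k ^+ 2 * a by rewrite mulr_ge0 ?sqr_ge0 // ltW.
lra.
Qed.

Section Coefficients.
Context {R : realType}.
Variables (sigma : nat -> R) (sigma_ge0 : forall k, 0 <= sigma k).
Hypothesis sigma_sqrt_log_le : forall a : R, 0 < a ->
  exists C, forall k, sigma k * sqrt_log k <= C + a * sigma k ^+ 2.

(** Along a subsequence with limit in [0 < r < +oo], the left-hand side of the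
    hypothesis grows like [r * sqrt_log k] while its right-hand side stays
    bounded. *)
Lemma accumulation_point_0y (l : \bar R) : (0 <= l)%E ->
  accumulation_point sigma l -> l = 0%E \/ l = +oo%E.
Proof.
case: l => [r|_ _|//]; last by right.
rewrite lee_fin le_eqVlt => /predU1P[<-|r0]; first by left.
move=> [phi phi_incr phir]; exfalso.
have [C HC] := sigma_sqrt_log_le ltr01.
have {}phir : sigma (phi n) @[n --> \oo] --> r by case/fine_cvgP: phir.
have near_lt : \forall n \near \oo, sigma (phi n) < 2 * r.
  by apply: (cvgr_lt _ phir); lra.
have near_gt : \forall n \near \oo, r / 2 < sigma (phi n).
  by apply: (cvgr_gt _ phir); lra.
have phi_ge n : (n <= phi n)%N.
  by elim: n => // n IH; apply: (leq_ltn_trans IH); exact: phi_incr.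
have /cvgryPge/(_ ((C + (2 * r) ^+ 2) / (r / 2) + 1)) [N _ HN] :=
  @sqrt_log_cvgy R.
have big : \forall n \near \oo,
    (C + (2 * r) ^+ 2) / (r / 2) + 1 <= sqrt_log (phi n).
  by exists N => // n /= Nn; apply: HN; exact: leq_trans (phi_ge n).
near \oo => n.
have h1 : sigma (phi n) < 2 * r by near: n.
have h2 : r / 2 < sigma (phi n) by near: n.
have h3 : (C + (2 * r) ^+ 2) / (r / 2) + 1 <= sqrt_log (phi n) by near: n.
have h4 := HC (phi n).
have h5 : sigma (phi n) ^+ 2 <= (2 * r) ^+ 2.
  by rewrite ler_pXn2r ?nnegrE ?(ltW h1) ?mulr_ge0 ?(ltW r0).
have h6 : r / 2 * sqrt_log (phi n) <= sigma (phi n) * sqrt_log (phi n).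
  by rewrite ler_wpM2r ?sqrt_log_ge0 // ltW.
have h7 : r / 2 * ((C + (2 * r) ^+ 2) / (r / 2) + 1) <=
    r / 2 * sqrt_log (phi n).
  by rewrite ler_wpM2l // divr_ge0 // ltW.
rewrite mulrDr mulrCA divff ?mulr1 in h7; last by rewrite gt_eqF // divr_gt0.
lra.
Unshelve. all: by end_near. Qed.

Lemma sigma_sqrt_log_bounded (S : R) : (forall k, sigma k <= S) ->
  exists C, forall k, sigma k * sqrt_log k <= C.
Proof.
move=> sS; have [C HC] := sigma_sqrt_log_le ltr01.
exists (C + S ^+ 2) => k; apply: (le_trans (HC k)).
by rewrite mul1r lerD2l ler_pXn2r ?nnegrE // (le_trans (sigma_ge0 k)).
Qed.

(** Here it matters that the hypothesis holds for arbitrarily small [a]: for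
    [a = 1 / (2 A)], and once [sigma k] is so large that [C <= a * sigma k ^ 2],
    it reads [sigma k * sqrt_log k <= sigma k ^ 2 / A]. *)
Lemma near_sqrt_log_le_sigma (A : R) : 0 < A ->
  sigma k @[k --> \oo] --> +oo ->
  \forall k \near \oo, A * sqrt_log k <= sigma k.
Proof.
move=> A0 /cvgryPge soo.
have a0 : 0 < 1 / (2 * A) by rewrite divr_gt0 // mulr_gt0.
have [C HC] := sigma_sqrt_log_le a0.
near=> k.
have s1 : 1 <= sigma k by near: k; exact: soo.
have s2 : 2 * A * C <= sigma k by near: k; exact: soo.
have s0 : 0 < sigma k by lra.
rewrite -(ler_pM2l s0) mulrCA.
apply: (@le_trans _ _ (A * (C + 1 / (2 * A) * sigma k ^+ 2))).
  by rewrite ler_wpM2l // ltW.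
rewrite mulrDr [X in _ + X](_ : _ = sigma k ^+ 2 / 2); last first.
  by field; rewrite gt_eqF.
have : sigma k <= sigma k * sigma k by rewrite ler_peMl // ltW.
rewrite expr2; lra.
Unshelve. all: by end_near. Qed.

Lemma ratio_cvgy : sigma k @[k --> \oo] --> +oo ->
  sigma k / sqrt_log k @[k --> \oo] --> +oo.
Proof.
move=> soo; apply/cvgryPge => A.
near=> k.
have L1 : 1 <= sqrt_log k :> R.
  near: k; move: (@sqrt_log_cvgy R) => /cvgryPge; exact.
have h : (`|A| + 1) * sqrt_log k <= sigma k.
  by near: k; apply: near_sqrt_log_le_sigma => //; rewrite ltr_wpDl.
rewrite ler_pdivlMr; last by lra.
apply: le_trans h; rewrite ler_wpM2r ?sqrt_log_ge0 //.
by rewrite (le_trans (ler_norm A)) // lerDl.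
Unshelve. all: by end_near. Qed.

End Coefficients.

(** * Brownian increments *)

Section Increments.
Context d (T : measurableType d) (R : realType) (P : probability T R).
Variables (W : nat -> R -> {RV P >-> R}).
Hypothesis W_wiener : forall k, wiener_process (W k).
Variables (s t : R) (s_ge0 : 0 <= s) (lt_st : s < t).

Let b := Num.sqrt (t - s).
Let b_gt0 : 0 < b. Proof. by rewrite sqrtr_gt0 subr_gt0. Qed.

Let measurable_increment k (B : set R) : measurable B ->
  measurable ((fun w => W k t w - W k s w) @^-1` B).
Proof.
move=> mB; rewrite -[X in measurable X]setTI.
by apply: (measurable_funB _ _ measurableT mB).
Qed.

(** The constant [3] makes the tail bound summable: at the level
    [3 * sqrt (t - s) * sqrt_log k] the exponent is [9 / 4 * sqrt_log k ^ 2],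
    which exceeds [2 * sqrt_log k ^ 2 = 2 * log (k + 1)]. *)
Lemma ae_increment_le : {ae P, forall w, \forall k \near \oo,
  W k t w - W k s w <= 3 * Num.sqrt (t - s) * sqrt_log k}.
Proof.
pose B k := [set x : R | x <= 3 * b * sqrt_log k].
have mB k : measurable (B k) by rewrite /B -set_itvNyc; exact: measurable_itv.
apply: (@ae_eventually _ _ _ _
  (fun k => (fun w => W k t w - W k s w) @^-1` B k)
  (fun k => Num.sqrt 2 * (k.+1%:R ^+ 2)^-1)).
- by move=> k; exact: measurable_increment.
- move=> k; rewrite preimage_setC.
  rewrite (wiener_gaussian (W_wiener k)) //; last exact: measurableC.
  rewrite (_ : ~` B k = `]3 * b * sqrt_log k, +oo[%classic); last first.
    by rewrite set_itvoy; apply/seteqP; split => x /=; rewrite ltNge => /negP.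
  have a0 : 0 <= 3 * b * sqrt_log k.
    by rewrite !mulr_ge0 ?sqrt_log_ge0 ?(ltW b_gt0).
  apply: (le_trans (normal_prob_tail b_gt0 a0)).
  rewrite lee_fin ler_wpM2l ?sqrtr_ge0 // -expR_sqrt_log ler_expR lerN2.
  rewrite [leRHS](_ : _ = 9 / 4 * sqrt_log k ^+ 2); last first.
    by field; rewrite gt_eqF.
  by rewrite ler_wpM2r ?sqr_ge0 //; lra.
- have -> : series (fun k => Num.sqrt 2 * (k.+1%:R ^+ 2)^-1 : R) =
      (fun n => Num.sqrt 2 * series (fun k => (k.+1%:R ^+ 2)^-1) n).
    by apply/funext => n; rewrite /series /= mulr_sumr.
  by apply: is_cvgMr; exact: cvg_series_inv_sqr.
Qed.

(** The level [- K] is only chosen so that an increment, whose law does not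
    depend on [k], exceeds it with positive probability. Any such level serves:
    its contribution to the eigenvalue exponent is [- sigma k * K], which is
    bounded below when [sigma] is bounded. *)
Lemma ae_increment_ge :
  independent_processes P (fun k t => W k t : T -> R) ->
  exists2 K : R, 0 <= K &
    {ae P, forall w, infinite_set [set k | - K <= W k t w - W k s w]}.
Proof.
move=> W_indep.
have [n] := probability_half_line (normal_prob 0 b).
set B := [set x : R | x < - n%:R] => q1.
have mB : measurable B by rewrite /B -set_itvNyo; exact: measurable_itv.
exists n%:R => //.
have fq : (normal_prob 0 b B : \bar R) \is a fin_num.
  by rewrite ge0_fin_numE // (lt_trans q1) ?ltry.
have q1' : fine (normal_prob 0 b B) < 1 by rewrite -lte_fin fineK.
have xi_lt := @ae_infinitely_often _ _ _ P
  (fun k => sigma_process (fun t => W k t : T -> R))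
  (fun k => (fun w => W k t w - W k s w) @^-1` B) _ W_indep _ _ q1'.
apply: filterS (xi_lt _ _ _) => [w|k|k|k].
- by apply: sub_infinite_set => k /= /negP; rewrite -leNgt.
- by apply: sigma_process_increment => //; exact: le_trans (ltW lt_st).
- exact: measurable_increment.
- by rewrite (wiener_gaussian (W_wiener k)) // fineK.
Qed.

End Increments.

(** * The eigenvalues along one path *)

Section Eigenvalues.
Context {R : realType}.
Variables (sigma : nat -> R) (sigma_ge0 : forall k, 0 <= sigma k).
Variables (tau : R) (tau_gt0 : 0 < tau) (xi : nat -> R).
(** One path of the eigenvalues: [xi] stands for the increments
   [W_k(t) - W_k(s)] at a fixed outcome and [tau] for [t - s]. *)
Let z k := expR (- (sigma k ^+ 2 / 2) * tau + sigma k * xi k).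

Hypothesis xi_le :
  \forall k \near \oo, xi k <= 3 * Num.sqrt tau * sqrt_log k.

Lemma eigenvalues_bounded (C : R) : (forall k, sigma k * sqrt_log k <= C) ->
  exists M, forall k, `|z k| <= M.
Proof.
move=> HC.
have [|M HM] := @near_le_bounded R z (expR (3 * Num.sqrt tau * C)).
  apply: filterS xi_le => k xik; rewrite ler_expR.
  have h1 : sigma k * xi k <= 3 * Num.sqrt tau * (sigma k * sqrt_log k).
    by rewrite mulrCA ler_wpM2l.
  have h2 : 3 * Num.sqrt tau * (sigma k * sqrt_log k) <= 3 * Num.sqrt tau * C.
    by rewrite ler_wpM2l // mulr_ge0 ?sqrtr_ge0.
  have h3 : 0 <= sigma k ^+ 2 / 2 * tau.
    by rewrite mulr_ge0 ?(ltW tau_gt0) // divr_ge0 ?sqr_ge0.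
  by rewrite mulNr; lra.
by exists M => k; rewrite ger0_norm ?expR_ge0.
Qed.

(** Put [b = sqrt tau], [r = sigma k] and [l = sqrt_log k]. If [8 * l <= r * b],
    then the exponent [- r^2 b^2 / 2 + 3 r b l] is at most [- (r b)^2 / 8],
    hence at most [- 2 l^2], and the eigenvalue is at most
    [exp (- 2 l^2) = 1 / (k + 1)^2]. *)
Lemma eigenvalues_summable :
  (forall A, 0 < A -> \forall k \near \oo, A * sqrt_log k <= sigma k) ->
  cvgn (series z).
Proof.
move=> HA; have b0 : 0 < Num.sqrt tau by rewrite sqrtr_gt0.
have [|D HD] := @near_le_bounded R (fun k => z k * k.+1%:R ^+ 2) 1.
  apply: filterS2 xi_le (HA _ (divr_gt0 (ltr0Sn R 7) b0)) => k xik.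
  rewrite mulrAC ler_pdivrMr // => Lk.
  rewrite -ler_pdivlMr ?exprn_gt0 // mul1r -expR_sqrt_log ler_expR.
  have h1 : sigma k * xi k <= sigma k * (3 * Num.sqrt tau * sqrt_log k).
    by rewrite ler_wpM2l.
  have tauE : tau = Num.sqrt tau ^+ 2 by rewrite sqr_sqrtr // ltW.
  have L0 := @sqrt_log_ge0 R k; have s0 := sigma_ge0 k.
  rewrite {1}tauE; move: h1 Lk.
  move: (Num.sqrt tau) (sqrt_log k) (sigma k) (xi k) b0 L0 s0.
  move=> b l r x b0 l0 r0 h1 Lk.
  have u0 : 0 <= r * b by rewrite mulr_ge0 // ltW.
  have h2 : 8 * l * (r * b) <= r * b * (r * b) by rewrite ler_wpM2r.
  have h3 : 8 * l * (8 * l) <= r * b * (r * b) by rewrite ler_pM // mulr_ge0.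
  nra.
apply: (@series_le_cvg _ _ (fun k => D * (k.+1%:R ^+ 2)^-1)).
- by move=> k; exact: expR_ge0.
- move=> k; rewrite mulr_ge0 ?invr_ge0 ?sqr_ge0 //.
  by apply: le_trans (HD 0); rewrite mulr_ge0 ?expR_ge0 ?sqr_ge0.
- by move=> k; rewrite ler_pdivlMr ?exprn_gt0.
- have -> : series (fun k => D * (k.+1%:R ^+ 2)^-1) =
      (fun n => D * series (fun k => (k.+1%:R ^+ 2)^-1) n).
    by apply/funext => n; rewrite /series /= mulr_sumr.
  by apply: is_cvgMr; exact: cvg_series_inv_sqr.
Qed.

Lemma eigenvalues_ge (S K : R) : (forall k, sigma k <= S) -> 0 <= K ->
  exists2 c, 0 < c & forall k, - K <= xi k -> c <= z k.
Proof.
move=> HS K0.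
exists (expR (- (S ^+ 2 / 2 * tau + S * K))); first exact: expR_gt0.
move=> k Kx; rewrite ler_expR.
have h1 : sigma k ^+ 2 <= S ^+ 2.
  by rewrite ler_pXn2r ?nnegrE // (le_trans (sigma_ge0 k)).
have h2 : sigma k ^+ 2 * tau <= S ^+ 2 * tau by rewrite ler_wpM2r // ltW.
have h3 : sigma k * - K <= sigma k * xi k by rewrite ler_wpM2l.
have h4 : sigma k * K <= S * K by rewrite ler_wpM2r.
lra.
Qed.

End Eigenvalues.

(** * Compactness and trace class of the random operator *)

Theorem proposition4p3 (R : realType) (H : completeNormedModType R)
  (ip : {dot H for idfun}) (ip_hilbert : hilbert_inner ip)
  (e : nat -> H) (e_basis : orthonormal_basis ip e)
  (d : measure_display) (T : measurableType d) (P : probability T R)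
  (W : nat -> R -> {RV P >-> R})
  (W_wiener : forall k, wiener_process (W k))
  (W_indep : independent_processes P (fun k t => W k t : T -> R))
  (sigma : nat -> R) (sigma_ge0 : forall k, 0 <= sigma k)
  (sigma_sup : forall s t : R, 0 <= s -> s < t ->
    (ereal_sup (range (fun k : nat =>
       (- (sigma k ^+ 2 / 2) * Num.sqrt (t - s)
        + sigma k * Num.sqrt (2 * ln (k.+1%:R)))%:E)) < +oo)%E) :
  forall s t : R, 0 <= s -> s < t ->
  let z (w : T) (k : nat) : R := zeta sigma W s t k w in
  let X (w : T) : H -> H := diag_op ip e (z w) in
  [/\ (* (i) *)
      forall l : \bar R, (0 <= l)%E -> accumulation_point sigma l ->
        l = 0%E \/ l = +oo%E,
      (* (ii) *)
      sigma k @[k --> \oo] --> 0 ->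
        [/\ (ereal_sup (range (fun k : nat =>
               (sigma k * Num.sqrt (ln (k.+1%:R)))%:E)) < +oo)%E,
            {ae P, forall w, (forall k, X w (e k) = z w k *: e k) /\
               exists2 l : \bar R, l != 0%E & accumulation_point (z w) l} &
            {ae P, forall w, [/\ diag_defined ip e (z w),
               bounded_operator (X w) & ~ compact_operator (X w)]}]
    & (* (iii) *)
      sigma k @[k --> \oo] --> +oo ->
        (sigma k / Num.sqrt (ln (k.+1%:R)) @[k --> \oo] --> +oo) /\
        {ae P, forall w, diag_defined ip e (z w) /\ trace_class ip (X w)}].
Proof.
move=> s t s0 st z X.
have e_on : orthonormal_sequence ip e by case: e_basis.
have tau0 : 0 < t - s by rewrite subr_gt0.
have sle := sigma_sqrt_log_le_of_sup sigma_ge0 sigma_sup.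
have xi_le := ae_increment_le W_wiener s0 st.
split; first by move=> l; exact: accumulation_point_0y.
- move=> sigma0.
  have [S HS] : exists S, forall k, sigma k <= S.
    by apply: (@near_le_bounded _ _ 1); apply: (cvgr_le _ sigma0).
  have [C HC] := sigma_sqrt_log_bounded sigma_ge0 sle HS.
  have [K K0 xi_ge] := ae_increment_ge W_wiener s0 st W_indep.
  (* Both facts about the spectrum are needed at the same outcome: the upper
     bound makes the operator bounded, the lower one prevents compactness. *)
  have spectrum : {ae P, forall w, (exists M, forall k, `|z w k| <= M) /\
      exists2 c, 0 < c & infinite_set [set k | c <= z w k]}.
    apply: filterS2 xi_le xi_ge => w xi_le xi_ge; split.
      exact: eigenvalues_bounded HC.
    have [c c0 cz] := @eigenvalues_ge _ _ sigma_ge0 _ tau0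
      (fun k => W k t w - W k s w) _ _ HS K0.
    exists c => //; apply: sub_infinite_set xi_ge => k; exact: cz.
  split.
  + apply: (@le_lt_trans _ _ C%:E); last exact: ltry.
    by apply: ge_ereal_sup => _ [k _ <-]; rewrite lee_fin; exact: HC.
  + apply: filterS spectrum => w [[M zM] [c c0 zoo]]; split.
      by move=> k; exact: diag_op_eigen.
    have [l cl lz] := accumulation_point_ge zoo (fun k => id) zM.
    by exists l%:E => //; rewrite eqe gt_eqF // (lt_le_trans c0).
  + apply: filterS spectrum => w [[M zM] [c c0 zoo]]; split.
    * exact: diag_definedP zM.
    * exact: diag_op_bounded zM.
    * exact: diag_op_not_compact zM c0 zoo.
- move=> sigmaoo; split; first exact: ratio_cvgy.
  apply: filterS xi_le => w xi_le.
  have zcvg : cvgn (series (z w)).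
    apply: eigenvalues_summable => // A A0; exact: near_sqrt_log_le_sigma.
  have z0 k : 0 <= z w k by exact: expR_ge0.
  split; first exact: diag_definedP (summable_le_lim z0 zcvg).
  exact: trace_class_diag_op.
Qed.
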